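(* Let $q\ge 1$ be an integer. There is a one-to-one correspondence between optimal self-locating-dominating codes in $K_q^3$ and $q\times q$ Latin squares, given by representing codes in a grid: the map sending a $q\times q$ Latin square $L$ to the code $\{(x,y,z)\mid 1\le x,y,z\le q,\ L(x,y)=z\}$ is a bijection from the set of $q\times q$ Latin squares onto the set of optimal self-locating-dominating codes in $K_q^3$.
   Context: $K_q^3=K_q\square K_q\square K_q$ is the graph with vertex set $V=\{(x,y,z)\in\mathbb{Z}^3\mid 1\le x,y,z\le q\}$ in which two distinct vertices are adjacent iff they differ in exactly one coordinate. $N[v]$ denotes the closed neighbourhood of $v$. A code is a nonempty subset $C\subseteq V$; its elements are codewords; $I(u)=N[u]\cap C$. A code $C$ is self-locating-dominating in a graph with vertex set $V$ if for each $u\in V\setminus C$ we have $I(u)\neq\emptyset$ and $\bigcap_{c\in I(u)}N[c]=\{u\}$. A self-locating-dominating code is optimal if it has the smallest cardinality among all self-locating-dominating codes in the graph. A $q\times q$ Latin square is a $q\times q$ array $L$ with entries $L(x,y)\in\{1,\dots,q\}$ ($1\le x,y\le q$) such that each number occurs exactly once in each row and in each column. The representation of a code in a $q\times q$ grid places in position $(x,y)$ the $z$-coordinates of the codewords $(x,y,z)$. *)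

(* Defs.v *)
From mathcomp Require Import all_boot all_algebra.

Set Implicit Arguments.
Unset Strict Implicit.
Unset Printing Implicit Defensive.

Section Graph.

(* A graph on the finite vertex set T is given by its adjacency relation. *)
Variables (T : finType) (adj : rel T).
Implicit Types (u v c : T) (C : {set T}).

Definition closed_nbhd v : {set T} := [set u | (u == v) || adj v u].

Definition is_code C : bool := C != set0.

Definition Iset C u : {set T} := closed_nbhd u :&: C.

Definition self_locating_dominating C : bool :=
  is_code C &&
  [forall u, (u \notin C) ==>
     (Iset C u != set0) && (\bigcap_(c in Iset C u) closed_nbhd c == [set u])].

Definition optimal_sld C : bool :=
  self_locating_dominating C &&
  [forall D : {set T}, self_locating_dominating D ==> (#|C| <= #|D|)].

End Graph.

(* Vertices ((x, y), z) have coordinates in {0, ..., q - 1} rather than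
   {1, ..., q}; Latin squares use the same index and symbol set. *)
Definition vertex (q : nat) : finType := ('I_q * 'I_q * 'I_q)%type.

(* The sum of booleans counts the coordinates in which u and v differ. *)
Definition Kq3_adj (q : nat) : rel (vertex q) := fun u v =>
  (u.1.1 != v.1.1) + (u.1.2 != v.1.2) + (u.2 != v.2) == 1.

Definition latin_square (q : nat) (L : 'M['I_q]_q) : bool :=
  [forall x, forall k, #|[set y | L x y == k]| == 1] &&
  [forall y, forall k, #|[set x | L x y == k]| == 1].

Definition latin_code (q : nat) (L : 'M['I_q]_q) : {set vertex q} :=
  [set v : vertex q | L v.1.1 v.1.2 == v.2].

(* Main.v *)
Require Import Defs.
From mathcomp Require Import all_boot all_algebra.
From mathcomp Require Import zify.

(** Call the three lines through a vertex the sets of vertices agreeing with it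
    in all but one given coordinate.  For a code C and a vertex u, let cover C u
    count the pairs made of a line through u and a codeword on that line; it
    is #|Iset C u|, plus 2 when u is itself a codeword, since u lies on all of
    its three lines.

    If C is self-locating-dominating then cover C u >= 3 everywhere
    ([cover_ge3]).  This is clear when u is a codeword.  Otherwise two codewords
    c, c' near u never isolate u: the vertex [corner u c c'], the fourth corner
    of the rectangle on u, c, c' (or c itself if u, c, c' are collinear), is near
    both and differs from u.  So u has at least three codewords near it.
    As each codeword is counted once by each vertex of its three lines,
    the covers add up to 3 q #|C| ([sum_cover]), whence q ^ 2 <= #|C|, and
    equality forces every cover to be exactly 3.  In that case no two codewords
    are adjacent, so each of the three projections onto two coordinates is
    injective on C, hence bijective by cardinality, and this is precisely what
    it means for C to be the code of a Latin square ([latin_code_surj]).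

    Conversely a Latin code has q ^ 2 elements and puts a codeword on each of
    the three lines through any u; three such codewords isolate u
    ([latin_code_sld]).  Since the addition table of the integers mod q is a
    Latin square, the bound q ^ 2 is attained, so the optimal codes are exactly
    the self-locating-dominating codes with q ^ 2 elements. *)

(** * The distance and the lines of the graph *)

Definition hdist {q : nat} (u v : vertex q) : nat :=
  (u.1.1 != v.1.1) + (u.1.2 != v.1.2) + (u.2 != v.2).

Definition near {q : nat} (u v : vertex q) : bool :=
  v \in closed_nbhd (@Kq3_adj q) u.

Lemma vertex_eqE {q : nat} (u v : vertex q) :
  (u == v) = [&& u.1.1 == v.1.1, u.1.2 == v.1.2 & u.2 == v.2].
Proof. by case: u v => [[x y] z] [[a b] c]; rewrite -!pair_eqE /= -andbA. Qed.

Lemma nearE {q : nat} (u v : vertex q) : near u v = (hdist u v <= 1).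
Proof.
rewrite /near inE eq_sym vertex_eqE /Kq3_adj /hdist.
by do 3!case: (_ == _).
Qed.

Lemma near_sym {q : nat} (u v : vertex q) : near u v = near v u.
Proof.
rewrite !nearE /hdist [u.1.1 == _]eq_sym [u.1.2 == _]eq_sym.
by rewrite [u.2 == _]eq_sym.
Qed.

Lemma near_refl {q : nat} (u : vertex q) : near u u.
Proof. by rewrite nearE /hdist !eqxx. Qed.

Lemma mem_Iset {q : nat} (C : {set vertex q}) (u c : vertex q) :
  (c \in Iset (@Kq3_adj q) C u) = near u c && (c \in C).
Proof. by rewrite inE. Qed.

(** The number of lines containing both vertices. *)
Definition colines {q : nat} (u v : vertex q) : nat :=
  ((u.1.1 == v.1.1) && (u.1.2 == v.1.2))
  + ((u.1.1 == v.1.1) && (u.2 == v.2))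
  + ((u.1.2 == v.1.2) && (u.2 == v.2)).

Lemma colinesE {q : nat} (u v : vertex q) :
  colines u v = near u v + 2 * (u == v).
Proof.
rewrite nearE vertex_eqE /colines /hdist.
by do 3!case: (_ == _).
Qed.

(** Counting the vertices u line by line: each of the three lines through c has
    q vertices, and each is parametrised by its free coordinate. *)
Lemma sum_colines {q : nat} (c : vertex q) : \sum_u colines u c = 3 * q.
Proof.
case: c => [[a b] d].
have line (f : 'I_q -> vertex q) (P : pred (vertex q)) :
    injective f -> (forall u, P u = (u \in codom f)) ->
    \sum_(u : vertex q) (P u : nat) = q.
  move=> finj PE; rewrite -[RHS]card_ord -(card_codom finj) -sum1_card.
  rewrite [RHS]big_mkcond; apply: eq_bigr => u _.
  by rewrite PE; case: (_ \in _).
rewrite !big_split /= (line (fun t => (a, b, t))) //; first last.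
- move=> [[x y] z] /=; apply/andP/codomP => [[/eqP-> /eqP->]|[t [-> -> _]]].
    by exists z.
  by rewrite !eqxx.
- by move=> t t' [].
rewrite (line (fun t => (a, t, d))) //; first last.
- move=> [[x y] z] /=; apply/andP/codomP => [[/eqP-> /eqP->]|[t [-> _ ->]]].
    by exists y.
  by rewrite !eqxx.
- by move=> t t' [].
rewrite (line (fun t => (t, b, d))) ?mulSn ?mul0n ?addn0 ?addnA //.
- by move=> t t' [].
move=> [[x y] z] /=; apply/andP/codomP => [[/eqP-> /eqP->]|[t [_ -> ->]]].
  by exists x.
by rewrite !eqxx.
Qed.

(** * The lower bound on the size of a self-locating-dominating code *)

Definition cover {q : nat} (C : {set vertex q}) (u : vertex q) : nat :=
  \sum_(c in C) colines u c.

Lemma sum_cover {q : nat} (C : {set vertex q}) :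
  \sum_u cover C u = 3 * q * #|C|.
Proof.
rewrite exchange_big /= (eq_bigr (fun=> 3 * q)) => [|c _]; last first.
  exact: sum_colines.
by rewrite sum_nat_const mulnC.
Qed.

(** The fourth corner of the rectangle with corners u, c, c' when c and c' lie
    on different lines through u; it is c when they lie on the same one. *)
Definition corner {q : nat} (u c c' : vertex q) : vertex q :=
  let off s t t' := if t == s then t' else t in
  ((off u.1.1 c.1.1 c'.1.1, off u.1.2 c.1.2 c'.1.2), off u.2 c.2 c'.2).

(** Coordinatewise, the corner departs from c only where c' departs from u, and
    from c' only where c departs from u. *)
Lemma hdist_corner {q : nat} (u c c' : vertex q) :
  hdist c (corner u c c') <= hdist u c' /\ hdist c' (corner u c c') <= hdist u c.
Proof.
have off (s t t' : 'I_q) : (t != (if t == s then t' else t) <= (s != t')) /\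
    (t' != (if t == s then t' else t) <= (s != t)).
  by rewrite [s == t]eq_sym; case: (eqVneq t s) => [->|_]; rewrite eqxx ?leq_b1.
by split; rewrite !leq_add // ?(off _ _ _).1 ?(off _ _ _).2.
Qed.

Lemma corner_eq {q : nat} (u c c' : vertex q) : corner u c c' = u -> c = u.
Proof.
have off (s t t' : 'I_q) : (if t == s then t' else t) = s -> t = s.
  by case: (eqVneq t s).
by case: u c => [[x y] z] [[a b] d] [/off-> /off-> /off->].
Qed.

Section Sld.

Context {q : nat} {C : {set vertex q}}.
Hypothesis C_sld : self_locating_dominating (@Kq3_adj q) C.

(** The vertex [corner u c c'] is near c and c' but is not u, so the codewords
    near u cannot be c and c' alone.  The case c = c' is allowed: it says that
    one codeword is not enough either. *)
Lemma sld_third {u c c'} : u \notin C ->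
  c \in Iset (@Kq3_adj q) C u -> c' \in Iset (@Kq3_adj q) C u ->
  exists2 d, d \in Iset (@Kq3_adj q) C u & (d != c) && (d != c').
Proof.
move=> uC; rewrite !mem_Iset => /andP[uc cC] /andP[uc' c'C].
have [_ /forallP/(_ u)] := andP C_sld; rewrite uC /= => /andP[_ /eqP capE].
have u_neq_c : u != c by apply: contraNneq uC => ->.
have [wc wc'] := hdist_corner u c c'.
have : corner u c c' \notin [set u].
  by rewrite inE; apply: contraNneq u_neq_c => /corner_eq->.
rewrite -capE => far; apply/exists_inP; apply: contraNT far => /exists_inPn none.
apply/bigcapP => d /none; rewrite negb_and !negbK => /orP[] /eqP->.
  by rewrite -[_ \in _]/(near _ _) nearE (leq_trans wc) // -nearE.
by rewrite -[_ \in _]/(near _ _) nearE (leq_trans wc') // -nearE.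
Qed.

Lemma cover_ge3 u : 3 <= cover C u.
Proof.
have [uC|uC] := boolP (u \in C).
  by rewrite /cover (bigD1 u) //= colinesE near_refl eqxx.
have -> : cover C u = #|Iset (@Kq3_adj q) C u|.
  rewrite /cover -sum1_card big_mkcond [RHS]big_mkcond; apply: eq_bigr => c _.
  rewrite mem_Iset andbC; case: ifP => //= cC.
  have /negPf u_neq_c : u != c by apply: contraNneq uC => ->.
  by rewrite colinesE u_neq_c muln0 addn0; case: near.
have [_ /forallP/(_ u)] := andP C_sld; rewrite uC /= => /andP[/set0Pn[c cI] _].
have [d dI /andP[dc _]] := sld_third uC cI cI.
have [e eI /andP[ec ed]] := sld_third uC cI dI.
have <- : #|[set e; d; c]| = 3.
  by rewrite -setUA cardsU1 cards2 !inE (negPf ec) (negPf ed) dc.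
apply/subset_leq_card/subsetP => v; rewrite in_setU in_set2 in_set1 -orbA.
by case/or3P => /eqP->.
Qed.

(** Summing [cover_ge3] over the q ^ 3 vertices gives 3 q ^ 3 <= 3 q #|C|. *)
Lemma sld_card_ge : 0 < q -> q ^ 2 <= #|C|.
Proof.
move=> q_gt0; rewrite -(leq_pmul2l (_ : 0 < 3 * q)) ?muln_gt0 // -sum_cover.
have <- : \sum_(u : vertex q) 3 = 3 * q * q ^ 2.
  by rewrite sum_nat_const !card_prod !card_ord; nia.
by apply: leq_sum => u _; apply: cover_ge3.
Qed.

(** When the bound is tight all covers equal 3.  A codeword contributes 3 to its
    own cover, which leaves no room for an adjacent one. *)
Lemma sld_card_eq_indep : #|C| = q ^ 2 ->
  {in C &, forall c d, near c d -> c = d}.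
Proof.
move=> C_card c d cC dC cd; apply/eqP; apply: contraT => c_neq_d.
have : \sum_(u : vertex q) 3 < \sum_u cover C u.
  rewrite (bigD1 c) //= [X in _ < X](bigD1 c) //= -addSn.
  apply: leq_add; last by apply: leq_sum => u _; apply: cover_ge3.
  rewrite /cover (bigD1 c) //= (bigD1 d) /=; last by rewrite dC eq_sym.
  by rewrite !colinesE near_refl cd eqxx.
by rewrite sum_cover C_card sum_nat_const !card_prod !card_ord; nia.
Qed.

End Sld.

(** * Codes of Latin squares *)

Section LatinCode.

Context {q : nat} {L : 'M['I_q]_q}.
Hypothesis L_latin : latin_square L.

Lemma latin_row x k : exists y, L x y = k.
Proof.
have [/forallP/(_ x)/forallP/(_ k)/cards1P[y Ey] _] := andP L_latin.
by exists y; apply/eqP; have := set11 y; rewrite -Ey inE.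
Qed.

Lemma latin_col y k : exists x, L x y = k.
Proof.
have [_ /forallP/(_ y)/forallP/(_ k)/cards1P[x Ex]] := andP L_latin.
by exists x; apply/eqP; have := set11 x; rewrite -Ex inE.
Qed.

Lemma latin_code_card : #|latin_code L| = q ^ 2.
Proof.
pose f (p : 'I_q * 'I_q) : vertex q := (p, L p.1 p.2).
have -> : latin_code L = f @: setT.
  apply/setP => v; rewrite inE; apply/eqP/imsetP => [Lv|[p _ ->] //].
  by exists v.1; rewrite // /f Lv; case: v {Lv}.
by rewrite card_imset => [|p p' []]; rewrite ?cardsT ?card_prod ?card_ord ?mulnn.
Qed.

(** If u = (x, y, z) is not a codeword, the square provides codewords (a, y, z),
    (x, b, z) and (x, y, L x y) on the three lines through u, with a <> x and
    b <> y.  Let (x', y', z') be near all three.  If x' = x it differs from the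
    first one in its first coordinate, so it agrees with u in the others; if
    y' = y the second one plays the same role; and if x' and y' both differ from
    x and y, it is too far from the third. *)
Lemma latin_code_sld : 0 < q ->
  self_locating_dominating (@Kq3_adj q) (latin_code L).
Proof.
move=> q_gt0; apply/andP; split.
  by rewrite /is_code -card_gt0 latin_code_card expn_gt0 q_gt0.
apply/forallP => -[[x y] z]; apply/implyP => uC.
have [[b Lb] [a La]] := (latin_row x z, latin_col y z).
have zI : ((x, y), L x y) \in Iset (@Kq3_adj q) (latin_code L) ((x, y), z).
  by rewrite mem_Iset nearE inE /hdist /= !eqxx leq_b1.
have yI : ((x, b), z) \in Iset (@Kq3_adj q) (latin_code L) ((x, y), z).
  by rewrite mem_Iset nearE inE /hdist /= Lb !eqxx addn0 leq_b1.
have xI : ((a, y), z) \in Iset (@Kq3_adj q) (latin_code L) ((x, y), z).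
  by rewrite mem_Iset nearE inE /hdist /= La !eqxx !addn0 leq_b1.
apply/andP; split; first by apply/set0Pn; exists (x, y, L x y).
rewrite eqEsubset; apply/andP; split; last first.
  rewrite sub1set; apply/bigcapP => c; rewrite mem_Iset => /andP[uc _].
  by rewrite -[_ \in _]/(near _ _) near_sym.
apply/subsetP => -[[x' y'] z'] /bigcapP near_all.
have := (near_all _ xI, near_all _ yI, near_all _ zI).
rewrite -![_ \in closed_nbhd _ _]/(near _ _) !nearE in_set1 vertex_eqE /hdist /=.
have /negPf b_y : b != y by apply: contraNneq uC => <-; rewrite inE /= Lb.
have /negPf ax : a != x by apply: contraNneq uC => <-; rewrite inE /= La.
rewrite [x' == x]eq_sym [y' == y]eq_sym [z' == z]eq_sym.
case: (eqVneq x x') => [<-|_].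
  by rewrite ax; case: (y == y'); case: (z == z') => -[[]].
by case: (eqVneq y y') => [<-|_] [[_]]; rewrite ?b_y.
Qed.

End LatinCode.

Lemma latin_code_inj {q : nat} : injective (@latin_code q).
Proof.
move=> L L' LL'; apply/matrixP => x y; apply/eqP.
have : (x, y, L x y) \in latin_code L by rewrite inE.
by rewrite LL' inE eq_sym.
Qed.

Lemma inj_in_onto {T rT : finType} {f : T -> rT} {A : {set T}} :
  {in A &, injective f} -> #|A| = #|rT| -> forall y, exists2 x, x \in A & f x = y.
Proof.
move=> f_inj A_card y; suff /imsetP[x xA ->] : y \in f @: A by exists x.
suff -> : f @: A = setT by [].
by apply/eqP; rewrite eqEcard subsetT cardsT card_in_imset // A_card leqnn.
Qed.

(** Two vertices with the same projection onto two coordinates are near each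
    other, so if no two codewords are adjacent all three projections are
    injective on C; having q ^ 2 elements, C then meets every line exactly once.
    The lines in the third direction make C the graph of an array L, the other
    two directions say that L is Latin. *)
Lemma latin_code_surj {q : nat} {C : {set vertex q}} :
  {in C &, forall c d, near c d -> c = d} -> #|C| = q ^ 2 ->
  exists2 L, latin_square L & latin_code L = C.
Proof.
move=> C_indep C_card.
have C_card2 : #|C| = #|{: 'I_q * 'I_q}| by rewrite card_prod card_ord mulnn.
have inj_xy : {in C &, injective (fun v => (v.1.1, v.1.2))}.
  move=> c d cC dC [cd1 cd2]; apply: C_indep => //.
  by rewrite nearE /hdist cd1 cd2 !eqxx leq_b1.
have inj_xz : {in C &, injective (fun v => (v.1.1, v.2))}.
  move=> c d cC dC [cd1 cd2]; apply: C_indep => //.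
  by rewrite nearE /hdist cd1 cd2 !eqxx addn0 leq_b1.
have inj_yz : {in C &, injective (fun v => (v.1.2, v.2))}.
  move=> c d cC dC [cd1 cd2]; apply: C_indep => //.
  by rewrite nearE /hdist cd1 cd2 !eqxx !addn0 leq_b1.
have col x y : exists z, (x, y, z) \in C.
  by have [[[a b] z] cC [<- <-]] := inj_in_onto inj_xy C_card2 (x, y); exists z.
pose L := (\matrix_(x, y) xchoose (col x y))%R : 'M['I_q]_q.
have LE x y z : (L x y == z) = ((x, y, z) \in C).
  have LC : (x, y, L x y) \in C by rewrite mxE (xchooseP (col x y)).
  apply/eqP/idP => [<- //|zC].
  by have [] := inj_xy _ _ LC zC erefl.
exists L; last by apply/setP => -[[x y] z]; rewrite inE /= LE.
apply/andP; split; apply/forallP => s; apply/forallP => k; apply/cards1P.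
- have [[[x y] z] cC [xs zk]] := inj_in_onto inj_xz C_card2 (s, k).
  exists y; apply/setP => y'; rewrite !inE LE -xs -zk.
  apply/idP/eqP => [c'C|-> //].
  by have [] := inj_xz _ _ c'C cC erefl.
have [[[x y] z] cC [ys zk]] := inj_in_onto inj_yz C_card2 (s, k).
exists x; apply/setP => x'; rewrite !inE LE -ys -zk.
apply/idP/eqP => [c'C|-> //].
by have [] := inj_yz _ _ c'C cC erefl.
Qed.

(** The addition table of the integers mod q. *)
Lemma latin_square_exists {q : nat} : 0 < q ->
  exists L : 'M['I_q]_q, latin_square L.
Proof.
case: q => // q _; exists (\matrix_(x, y) (x + y))%R.
apply/andP; split; apply/forallP => s; apply/forallP => k; apply/cards1P;
  exists (k - s)%R; apply/setP => t; rewrite !inE mxE.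
  by rewrite [RHS]eq_sym GRing.subr_eq eq_sym GRing.addrC.
by rewrite [RHS]eq_sym GRing.subr_eq eq_sym.
Qed.

Theorem theorem12 (q : nat) (hq : 1 <= q) :
  {in [set L : 'M['I_q]_q | latin_square L] &, injective (@latin_code q)} /\
  [set latin_code L | L in [set L : 'M['I_q]_q | latin_square L]]
    = [set C : {set vertex q} | optimal_sld (@Kq3_adj q) C].
Proof.
split; first by move=> L L' _ _; apply: latin_code_inj.
apply/setP => C; rewrite inE; apply/imsetP/andP => [[L] | [C_sld C_min]].
  rewrite inE => L_latin ->; split; first exact: latin_code_sld.
  apply/forallP => D; apply/implyP => D_sld.
  by rewrite latin_code_card sld_card_ge.
have [L0 L0_latin] := latin_square_exists hq.
have C_card : #|C| = q ^ 2.
  apply/eqP; rewrite eqn_leq sld_card_ge // andbT -(@latin_code_card q L0).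
  by have /forallP/(_ (latin_code L0)) := C_min; rewrite latin_code_sld.
have [L L_latin LC] := latin_code_surj (sld_card_eq_indep C_sld C_card) C_card.
by exists L; rewrite ?inE.
Qed.
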